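(* Let $G_S$ be a pseudo-connected self-loop graph with $|S|\ge1$ and loop vector $s$, and let $\widetilde G$ be its Açıkmeşe lift. Then $$\mathcal{I}_{eq}(\widetilde G)=-\frac{2\,s^\top\mathcal{L}(G_S)^{-3}s}{1+2\,s^\top\mathcal{L}(G_S)^{-2}s}.$$
   Context: Let $G$ be a finite undirected simple graph with vertex set $V=\{1,\dots,N\}$, and $S\subseteq V$. The self-loop graph $G_S$ is obtained from $G$ by attaching one loop at every vertex of $S$. $G_S$ is pseudo-connected if every connected component contains at least one looped vertex. The loop vector $s\in\mathbb{R}^N$ is the indicator vector of $S$. $\mathcal{L}(G)=D(G)-A(G)$ is the ordinary Laplacian and $\mathcal{L}(G_S):=\mathcal{L}(G)+\mathrm{diag}(s)$; it is positive definite when $G_S$ is pseudo-connected. For $|S|\ge1$, the Açıkmeşe lift $\widetilde G=(\widetilde V,\widetilde E)$ of $G_S$ is the simple graph on $\widetilde V=\{1,\dots,2N+1\}$ such that: for each edge $\{i,j\}$ of $G$, both $\{i,j\}$ and $\{i+N+1,j+N+1\}$ are edges of $\widetilde G$; for each $i\in S$, both $\{i,N+1\}$ and $\{N+1,i+N+1\}$ are edges; there are no other edges. $\mathcal{L}(\widetilde G)$ is the ordinary Laplacian of $\widetilde G$. The involution matrix $T$ is the $(2N+1)\times(2N+1)$ permutation matrix of the map swapping $i\leftrightarrow i+N+1$ ($1\le i\le N$) and fixing $N+1$. For the nontrivial element $g$ of $\mathbb{Z}_2$, $\chi_t^{\widetilde G}(g)=\mathrm{Tr}(e^{-t\mathcal{L}(\widetilde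 G)}T)$, $t>0$. The regularized equivariant heat integral is $\mathcal{I}_{eq}(\widetilde G)=\int_0^\infty(\chi_t^{\widetilde G}(g)-1)\,dt$. *)

(* Defs.v *)
From HB Require Import structures.
From mathcomp Require Import all_boot all_order all_algebra perm.
From mathcomp Require Import all_classical all_reals all_analysis.

Set Implicit Arguments.
Unset Strict Implicit.
Unset Printing Implicit Defensive.

Import Order.TTheory GRing.Theory Num.Theory.
Import numFieldNormedType.Exports.

Local Open Scope ring_scope.

(* Vertices are numbered from 0: 'I_n stands for {1, ..., n}. *)
Record simple_graph (n : nat) := SimpleGraph {
  adj : rel 'I_n;
  adj_sym : symmetric adj;
  adj_irr : irreflexive adj }.

Record selfloop_graph (n : nat) := SelfLoopGraph {
  base : simple_graph n;
  loops : {set 'I_n} }.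

Definition pseudo_connected n (GS : selfloop_graph n) : Prop :=
  forall v : 'I_n,
    exists2 w : 'I_n, w \in loops GS & connect (adj (base GS)) v w.

Section Laplacians.
Variable R : realType.

Definition degree n (G : simple_graph n) (i : 'I_n) : nat :=
  #|[set j | adj G i j]|.

Definition degree_mx n (G : simple_graph n) : 'M[R]_n :=
  diag_mx (\row_i (degree G i)%:R).

Definition adjacency_mx n (G : simple_graph n) : 'M[R]_n :=
  \matrix_(i, j) (adj G i j)%:R.

Definition laplacian n (G : simple_graph n) : 'M[R]_n :=
  degree_mx G - adjacency_mx G.

Definition loop_vector n (GS : selfloop_graph n) : 'cV[R]_n :=
  \col_i (i \in loops GS)%:R.

Definition sl_laplacian n (GS : selfloop_graph n) : 'M[R]_n :=
  laplacian (base GS) + diag_mx (loop_vector GS)^T.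

End Laplacians.

Section Lift.
Variable N : nat.

(* With 0-based numbering, [lo i], [mid] and [hi i] have values i, N and
   N + 1 + i in the vertex set of size N + 1 + N = 2N + 1. *)
Definition lo (i : 'I_N) : 'I_(N + 1 + N) := lshift N (lshift 1 i).
Definition mid : 'I_(N + 1 + N) := lshift N (rshift N ord0).
Definition hi (i : 'I_N) : 'I_(N + 1 + N) := rshift (N + 1) i.

Variable GS : selfloop_graph N.

Definition lift_adj : rel 'I_(N + 1 + N) := fun x y =>
  [exists i, exists j, adj (base GS) i j &&
     (([set x; y] == [set lo i; lo j]) || ([set x; y] == [set hi i; hi j]))]
  || [exists i in loops GS,
     ([set x; y] == [set lo i; mid]) || ([set x; y] == [set mid; hi i])].

Lemma lift_adj_sym : symmetric lift_adj.
Proof. by move=> x y; rewrite /lift_adj finset.setUC. Qed.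

Lemma lift_adj_irr : irreflexive lift_adj.
Proof.
have E (x a b : 'I_(N + 1 + N)) : a != b -> ([set x; x] == [set a; b]) = false.
  move=> ab; apply/eqP => /(congr1 (fun A : {set _} => #|A|)).
  by rewrite finset.setUid cards1 cards2 ab.
have lo_inj : injective lo by move=> i j /lshift_inj/lshift_inj.
have hi_inj : injective hi by move=> i j /rshift_inj.
move=> x; apply/negbTE; rewrite negb_or; apply/andP; split.
  apply/existsPn => i; apply/existsPn => j; rewrite negb_and.
  have [->|ij] := eqVneq i j; first by rewrite adj_irr.
  by rewrite !E ?orbT // ?(inj_eq lo_inj) ?(inj_eq hi_inj).
apply/existsPn => i; rewrite negb_and !E ?orbT //.
  by rewrite /mid /hi eq_lrshift.
by rewrite /lo /mid (inj_eq (@lshift_inj _ _)) eq_lrshift.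
Qed.

Definition acikmese_lift : simple_graph (N + 1 + N) :=
  SimpleGraph lift_adj_sym lift_adj_irr.

End Lift.

Section Involution.
Variable N : nat.

Definition swap (x : 'I_(N + 1 + N)) : 'I_(N + 1 + N) :=
  match fintype.split x with
  | inl y => match fintype.split y with inl i => hi i | inr _ => mid N end
  | inr i => lo i
  end.

Lemma swap_lo (i : 'I_N) : swap (lo i) = hi i.
Proof. by rewrite /swap /lo !(unsplitK (inl _)). Qed.

Lemma swap_mid : swap (mid N) = mid N.
Proof. by rewrite /swap /mid (unsplitK (inl _)) (unsplitK (inr _)). Qed.

Lemma swap_hi (i : 'I_N) : swap (hi i) = lo i.
Proof. by rewrite /swap /hi (unsplitK (inr _)). Qed.

Lemma swapK : involutive swap.
Proof.
move=> x; case: (fintype.split_ordP x) => [y ->|i ->].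
  case: (fintype.split_ordP y) => [i ->|j ->]; first by rewrite swap_lo swap_hi.
  by rewrite (ord1 j) !swap_mid.
by rewrite swap_hi swap_lo.
Qed.

Definition swap_perm : {perm 'I_(N + 1 + N)} := perm (inv_inj swapK).

Definition involution_mx (R : realType) : 'M[R]_(N + 1 + N) :=
  perm_mx swap_perm.

End Involution.

Section HeatTrace.
Variable R : realType.

Definition expmx n (A : 'M[R]_n) : 'M[R]_n :=
  limn (series (fun k : nat => (k`!%:R)^-1 *: A ^+ k)).

Variable N : nat.
Variable GS : selfloop_graph N.

(* The equivariant heat trace at the nontrivial element of Z_2. *)
Definition eq_heat_trace (t : R) : R :=
  \tr (expmx (- t *: laplacian R (acikmese_lift GS)) *m involution_mx N R).

(* Extended-real valued, so that equality with a real number also expresses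
   the convergence of the integral. *)
Definition eq_heat_integral : \bar R :=
  (\int[@lebesgue_measure R]_(t in `[0%R, +oo[) (eq_heat_trace t - 1)%:E)%E.

End HeatTrace.

(* Main.v *)
Require Import Defs.
From mathcomp Require Import all_boot all_order all_algebra perm.
From mathcomp Require Import complex.
From mathcomp Require Import all_classical all_reals all_analysis.
From mathcomp Require Import measurable_realfun ring lra.

(** The heat semigroup of a symmetric positive semidefinite matrix A splits off
the projector Q on ker A, and the remainder decays exponentially.  Integrating
it over time therefore gives a pseudo-inverse: for every matrix T,
  int_0^oo (tr (e^(-tA) T) - tr (Q T)) dt = tr (A^+ T),
where A^+ is the inverse of A on the range of 1 - Q.  If Y is any generalized
inverse (A Y A = A), then A^+ = (1 - Q) Y (1 - Q), so the value of the integral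
is tr (Y (1 - Q) T (1 - Q)).  This is [integral_heat_trace]; its proof expands A
over an eigenbasis, which turns both e^(-tA) and A^+ into finite sums.

For the Laplacian Lam of the lift, with vertices in the order lower copy,
middle vertex, upper copy, an explicit generalized inverse is
  Y = diag (L^-1, 0, L^-1),   L = L(G_S).
It works because L 1 = s, that is L^-1 s = 1, which gives Y Lam x the blocks
x_lo - x_mid 1, 0 and x_hi - x_mid 1.  The same formula shows that ker Lam
consists of the constant vectors, so Q = J / (2N + 1) with J the all-ones matrix
([lift_kernel_projector]).  The involution T fixes J on both sides; hence
tr (Q T) = 1, the constant subtracted from the heat trace, and
  (1 - Q) T (1 - Q) = T - Q.
Since T exchanges the two copies, Y T has zero diagonal, so only the Q term is
left and the integral equals
  - tr (Y J) / (2N + 1) = - 2 (1^T L^-1 1) / (2N + 1).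
Finally s^T L^-3 s = 1^T L^-1 1 and s^T L^-2 s = 1^T 1 = N, again by L^-1 s = 1. *)

Set Implicit Arguments.
Unset Strict Implicit.
Unset Printing Implicit Defensive.

Import Order.TTheory GRing.Theory Num.Theory.
Import numFieldNormedType.Exports.
Local Open Scope ring_scope.

(** * Spectral resolution of real symmetric matrices *)

Section Spectral.
Variable R : rcfType.

(** The values [lam m] may repeat, and a single [P m] need not be idempotent: in
[symmetric_spectral] it is the real part of a complex projector.  The sum of the
[P m] sharing one eigenvalue is its eigenprojector, and the three equations
determine every power of [A]. *)
Definition spectral_resolution n (A : 'M[R]_n) (lam : 'I_n -> R)
    (P : 'I_n -> 'M[R]_n) : Prop :=
  [/\ \sum_m P m = 1%:M, forall m, A *m P m = lam m *: P m
    & forall m, P m *m A = lam m *: P m].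

(** A real symmetric matrix is Hermitian over the complex numbers, where the
spectral theorem diagonalizes it by a unitary matrix with real eigenvalues.  The
real parts of the complex projectors satisfy the same equations, because these
are linear in the projectors with real coefficients. *)
Lemma symmetric_spectral n (A : 'M[R]_n) :
  A^T = A -> exists lam P, spectral_resolution A lam P.
Proof.
move=> symA.
pose C : numClosedFieldType := complex.complex R.
pose toC : R -> C := real_complex R.
pose re : C -> R := @complex.Re R.
have reD : {morph re : x y / x + y} by move=> [? ?] [? ?].
have re0 : re 0 = 0 by [].
have reMl a z : re (toC a * z) = a * re z.
  by case: z => x y; rewrite /re /toC /= mul0r subr0.
have reMr a z : re (z * toC a) = a * re z by rewrite mulrC reMl.
pose AC := map_mx toC A.
have AC_real : AC \is a mxOver Num.real.
  apply/mxOverP=> i j; rewrite !mxE.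
  rewrite realE (_ : toC (A i j) = complex.Complex (A i j) 0) //.
  rewrite !complex.lecE /= !eqxx /=.
  exact: le_total.
have AC_herm : AC \is hermsymmx.
  apply: realsym_hermsym => //; apply/is_hermitianmxP.
  rewrite expr0 scale1r; apply/matrixP => i j.
  by rewrite !mxE /= -[in LHS]symA mxE.
have /orthomx_spectralP := hermitian_normalmx AC_herm.
have Uunit := spectral_unit AC.
have := hermitian_spectral_diag_real AC_herm.
set U := spectralmx AC; set d := spectral_diag AC => d_real AC_eq.
pose E m := invmx U *m delta_mx m m *m U.
have sumE : \sum_m E m = 1%:M.
  rewrite -mulmx_suml -mulmx_sumr (_ : \sum_m _ = 1%:M) ?mulmx1 ?mulVmx //.
  rewrite [RHS](_ : _ = diag_mx (const_mx 1)); last by rewrite diag_const_mx.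
  rewrite diag_mx_sum_delta.
  by apply: eq_bigr => m _; rewrite mxE scale1r.
have diag_delta m : diag_mx d *m delta_mx m m = d 0 m *: delta_mx m m.
  rewrite mul_diag_mx; apply/matrixP => i j; rewrite !mxE.
  by case: eqP => [->|_] //=; rewrite !mulr0.
have delta_diag m : delta_mx m m *m diag_mx d = d 0 m *: delta_mx m m.
  rewrite mul_mx_diag; apply/matrixP => i j; rewrite !mxE mulrC.
  by rewrite andbC; case: eqP => [->|_] //=; rewrite !mulr0.
have AE m : AC *m E m = d 0 m *: E m.
  rewrite AC_eq /E !mulmxA mulmxK //.
  by rewrite -(mulmxA _ (diag_mx d)) diag_delta -scalemxAr -scalemxAl.
have EA m : E m *m AC = d 0 m *: E m.
  rewrite AC_eq /E !mulmxA mulmxK //.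
  by rewrite -(mulmxA _ (delta_mx m m)) delta_diag -scalemxAr -scalemxAl.
pose lam m := re (d 0 m).
have dE m : d 0 m = toC (lam m).
  have /mxOverP/(_ 0 m) := d_real.
  rewrite realE /lam /re /toC; case: (d 0 m) => x y.
  by rewrite !complex.lecE /= (eq_sym 0) -andb_orr => /andP[/eqP ->].
exists lam, (fun m => map_mx re (E m)); split.
- apply/matrixP => i j; rewrite summxE.
  rewrite (eq_bigr (fun m => re (E m i j))); last by move=> m _; rewrite mxE.
  rewrite -(big_morph _ reD re0) -summxE sumE !mxE.
  by case: (i == j).
- move=> m; apply/matrixP => i j; rewrite mxE [RHS]mxE [X in _ = _ * X]mxE.
  rewrite -reMl -dE.
  have /matrixP/(_ i j) := AE m.
  rewrite [RHS]mxE => <-; rewrite mxE (big_morph _ reD re0).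
  by apply: eq_bigr => k _; rewrite [AC _ _]mxE reMl [map_mx _ _ _ _]mxE.
- move=> m; apply/matrixP => i j; rewrite mxE [RHS]mxE [X in _ = _ * X]mxE.
  rewrite -reMl -dE.
  have /matrixP/(_ i j) := EA m.
  rewrite [RHS]mxE => <-; rewrite mxE (big_morph _ reD re0).
  by apply: eq_bigr => k _; rewrite [AC _ _]mxE reMr [map_mx _ _ _ _]mxE mulrC.
Qed.

(** A nonzero column of [P m] is an eigenvector, and the quadratic form at this
vector is its eigenvalue times a positive number. *)
Lemma psd_spectral n (A : 'M[R]_n) :
  A^T = A -> (forall x : 'cV_n, 0 <= (x^T *m A *m x) 0 0) ->
  exists lam P, spectral_resolution A lam P /\ forall m, 0 <= lam m.
Proof.
move=> /symmetric_spectral[lam [P [sumP AP PA]]] psd.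
(* If [P m = 0] there is no eigenvector to test, and any eigenvalue fits. *)
exists (fun m => if P m == 0 then 0 else lam m), P; split; first split=> //.
- by move=> m; case: eqP (AP m) => // ->; rewrite !scaler0.
- by move=> m; case: eqP (PA m) => // ->; rewrite !scaler0.
move=> m; case: eqP => // /eqP Pm_neq0.
have [j Pj] : exists j, col j (P m) != 0.
  apply/existsP; apply: contra_neqT Pm_neq0 => /existsPn Pm0.
  apply/matrixP => i j; have /negPn/eqP/matrixP/(_ i 0) := Pm0 j.
  by rewrite !mxE.
have := psd (col j (P m)); set x := col j (P m) in Pj *.
rewrite -mulmxA.
have -> : A *m x = lam m *: x by rewrite /x !colE mulmxA AP -scalemxAl.
rewrite -scalemxAr mxE.
have xx_gt0 : 0 < (x^T *m x) 0 0.
  rewrite mxE; have /cV0Pn[i xi] := Pj.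
  rewrite (bigD1 i) //= ltr_wpDr //.
    by apply: sumr_ge0 => k _; rewrite !mxE -expr2 sqr_ge0.
  by rewrite !mxE -expr2 exprn_even_gt0 //=; move: xi; rewrite !mxE.
by rewrite pmulr_lge0.
Qed.
End Spectral.

(** * Integrating the heat semigroup *)

Section Heat.
Local Open Scope classical_set_scope.
Variable R : realType.

Lemma spectral_resolution_exp n (A : 'M[R]_n) lam P k :
  spectral_resolution A lam P -> A ^+ k = \sum_m lam m ^+ k *: P m.
Proof.
move=> [sumP AP _]; elim: k => [|k IH].
  by rewrite expr0 -[1]/(1%:M) -sumP; apply: eq_bigr => m _; rewrite scale1r.
rewrite exprS IH -mulmxE mulmx_sumr; apply: eq_bigr => m _.
by rewrite -scalemxAr AP scalerA exprSr.
Qed.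

Lemma expmx_spectral n (A : 'M[R]_n) lam P :
  spectral_resolution A lam P -> expmx A = \sum_m expR (lam m) *: P m.
Proof.
move=> specA; apply: cvg_lim => //.
have -> : series (fun k => (k`!%:R)^-1 *: A ^+ k) =
    (fun K => \sum_m series (exp_coeff (lam m)) K *: P m).
  apply/funext => K; rewrite /series /=.
  under eq_bigr do rewrite (spectral_resolution_exp _ specA) scaler_sumr.
  rewrite exchange_big /=; apply: eq_bigr => m _.
  by rewrite scaler_suml; apply: eq_bigr => k _; rewrite scalerA mulrC.
apply: cvg_big => [|m _]; last first.
  by apply: cvgZr_tmp; exact: is_cvg_series_exp_coeff.
by move=> x; apply: add_continuous.
Qed.

Lemma spectral_resolutionZ n (A : 'M[R]_n) lam P a :
  spectral_resolution A lam P ->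
  spectral_resolution (a *: A) (fun m => a * lam m) P.
Proof.
by move=> [sumP AP PA]; split=> // m;
  rewrite -?scalemxAl -?scalemxAr (AP, PA) scalerA.
Qed.

Local Notation mu := (@lebesgue_measure R).

Lemma measurable_exp_decay (a : R) (D : set R) :
  measurable_fun D (fun t => (expR (- t * a))%:E).
Proof.
apply/measurable_EFinP; apply: measurable_funTS.
apply: continuous_measurable_fun => t.
apply: continuous_comp; last exact: continuous_expR.
by apply: cvgMr_tmp; apply: cvgN.
Qed.

Lemma integral_exp_decay (a : R) : 0 < a ->
  (\int[mu]_(t in `[0%R, +oo[) (expR (- t * a))%:E = (a^-1)%:E)%E.
Proof.
move=> a_gt0; have := integral_exponential_pdf a_gt0.
have -> : (fun t => (exponential_pdf a t)%:E) =
    ((fun t => a%:E * (expR (- t * a))%:E) \_ `[0%R, +oo[)%E.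
  apply/funext => t; rewrite /exponential_pdf !patchE.
  by case: ifP => _ //; rewrite !mulNr (mulrC t) EFinM.
rewrite -integral_mkcond ge0_integralZl_EFin ?ltW //; last first.
  exact: measurable_exp_decay.
move=> /(congr1 (fun x => a^-1%:E * x)%E).
by rewrite muleA -EFinM mulVf ?gt_eqF // mul1e mule1.
Qed.

Lemma integrable_exp_decay (a : R) : 0 < a ->
  mu.-integrable `[0%R, +oo[ (fun t => (expR (- t * a))%:E).
Proof.
move=> a_gt0; apply/integrableP; split; first exact: measurable_exp_decay.
under eq_integral do rewrite /= ger0_norm ?expR_ge0 //.
by rewrite integral_exp_decay // ltry.
Qed.

(** The terms with zero exponent are constant in time and are exactly what is
subtracted; every other term is integrable. *)
Lemma integral_sum_exp_decay (I : finType) (lam c : I -> R) :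
  (forall m, 0 <= lam m) ->
  (\int[mu]_(t in `[0%R, +oo[)
     (\sum_m expR (- t * lam m) * c m - \sum_(m | lam m == 0) c m)%:E =
   (\sum_(m | lam m != 0) (lam m)^-1 * c m)%:E)%E.
Proof.
move=> lam_ge0.
pose h m t := if lam m == 0 then 0%E else ((c m)%:E * (expR (- t * lam m))%:E)%E.
have lam_gt0 m : lam m != 0 -> 0 < lam m by move=> lm; rewrite lt_def lm lam_ge0.
have h_int m : mu.-integrable `[0%R, +oo[ (h m).
  rewrite /h; case: eqP => [_|/eqP/lam_gt0 lm]; first exact: integrable0.
  by apply: integrableZl => //; exact: integrable_exp_decay.
have sumE t : (\sum_m expR (- t * lam m) * c m
    - \sum_(m | lam m == 0) c m)%:E = (\sum_m h m t)%E.
  rewrite (bigID (fun m => lam m == 0)) /=.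
  have -> : \sum_(m | lam m == 0) expR (- t * lam m) * c m =
      \sum_(m | lam m == 0) c m.
    by apply: eq_bigr => m /eqP ->; rewrite mulr0 expR0 mul1r.
  rewrite addrAC subrr add0r big_mkcond /= -sumEFin.
  by apply: eq_bigr => m _; rewrite /h; case: eqP => //= _; rewrite mulrC EFinM.
under eq_integral do rewrite sumE.
rewrite /= integral_sum // [in RHS]big_mkcond /= -sumEFin.
apply: eq_bigr => m _; rewrite /h; case: eqP => /= [_|/eqP/lam_gt0 lm].
  by rewrite integral0.
rewrite integralZl //; last exact: integrable_exp_decay.
by rewrite integral_exp_decay // -EFinM mulrC.
Qed.

(** Integrating e^(-t lam) for lam > 0 gives 1 / lam, so the integral of the
decaying part of e^(-tA) is the sum [Z] of the [P m] / lam over the nonzero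
eigenvalues: the pseudo-inverse of [A].  Expressing [Z] through an arbitrary
generalized inverse [Y] makes the value computable without the eigenvalues.  The
first three conclusions on [Q] characterize the spectral projector on the
kernel. *)
Lemma integral_heat_trace n (A T Y : 'M[R]_n) :
  A^T = A -> (forall x : 'cV_n, 0 <= (x^T *m A *m x) 0 0) ->
  A *m Y *m A = A ->
  exists Q : 'M[R]_n,
    [/\ A *m Q = 0, Q *m A = 0, forall x : 'cV_n, A *m x = 0 -> Q *m x = x &
    (\int[mu]_(t in `[0%R, +oo[)
       (\tr (expmx (- t *: A) *m T) - \tr (Q *m T))%:E =
     (\tr (Y *m ((1%:M - Q) *m T *m (1%:M - Q))))%:E)%E].
Proof.
move=> symA psdA AYA; have [lam [P [specA lam_ge0]]] := psd_spectral symA psdA.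
have [sumP AP PA] := specA.
pose Q := \sum_(m | lam m == 0) P m.
pose Z := \sum_(m | lam m != 0) (lam m)^-1 *: P m.
have AQ : A *m Q = 0.
  by rewrite mulmx_sumr big1 // => m /eqP lm; rewrite AP lm scale0r.
have QA : Q *m A = 0.
  by rewrite mulmx_suml big1 // => m /eqP lm; rewrite PA lm scale0r.
have PnQ : \sum_(m | lam m != 0) P m = 1%:M - Q.
  by rewrite -sumP [in RHS](bigID (fun m => lam m == 0)) /= addrAC subrr add0r.
have ZA : Z *m A = 1%:M - Q.
  rewrite -PnQ mulmx_suml; apply: eq_bigr => m lm.
  by rewrite -scalemxAl PA scalerA mulVf // scale1r.
have AZ : A *m Z = 1%:M - Q.
  rewrite -PnQ mulmx_sumr; apply: eq_bigr => m lm.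
  by rewrite -scalemxAr AP scalerA mulVf // scale1r.
have QZ : Q *m Z = 0.
  rewrite /Z mulmx_sumr big1 // => m lm.
  have : Q *m (A *m P m) = 0 by rewrite mulmxA QA mul0mx.
  rewrite AP -!scalemxAr => /eqP.
  by rewrite scaler_eq0 (negbTE lm) => /eqP ->; rewrite scaler0.
(* Z A Y A Z = Z A Z = (1 - Q) Z = Z. *)
have Zpinv : (1%:M - Q) *m Y *m (1%:M - Q) = Z.
  rewrite -{1}ZA -AZ !mulmxA -2!(mulmxA Z) AYA.
  by rewrite ZA mulmxBl mul1mx QZ subr0.
exists Q; split=> //.
  move=> x Ax0; have : (Z *m A) *m x = 0 by rewrite -mulmxA Ax0 mulmx0.
  by rewrite ZA mulmxBl mul1mx => /eqP; rewrite subr_eq0 eq_sym => /eqP.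
have -> : \tr (Q *m T) = \sum_(m | lam m == 0) \tr (P m *m T).
  by rewrite /Q mulmx_suml raddf_sum.
have -> : \tr (Y *m ((1%:M - Q) *m T *m (1%:M - Q))) =
    \sum_(m | lam m != 0) (lam m)^-1 * \tr (P m *m T).
  rewrite mulmxA mxtrace_mulC !mulmxA Zpinv /Z mulmx_suml raddf_sum.
  by apply: eq_bigr => m _ /=; rewrite -scalemxAl mxtraceZ.
rewrite -integral_sum_exp_decay //.
apply: eq_integral => t _; congr (_ - _)%:E.
rewrite (expmx_spectral (spectral_resolutionZ _ specA)) mulmx_suml raddf_sum.
by apply: eq_bigr => m _ /=; rewrite -scalemxAl mxtraceZ.
Qed.

End Heat.

(** * The Laplacian of a self-loop graph *)

Section Laplacian.
Variable R : realType.

Lemma degreeE n (G : simple_graph n) i :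
  (degree G i)%:R = \sum_j (adj G i j)%:R :> R.
Proof.
rewrite /degree -sum1dep_card natr_sum big_mkcond /=.
by apply: eq_bigr => j _; case: adj.
Qed.

Lemma laplacianE n (G : simple_graph n) i j :
  laplacian R G i j = (degree G i)%:R *+ (i == j) - (adj G i j)%:R.
Proof. by rewrite !mxE. Qed.

Lemma laplacian_tr n (G : simple_graph n) : (laplacian R G)^T = laplacian R G.
Proof.
apply/matrixP => i j; rewrite mxE !laplacianE adj_sym eq_sym.
by case: eqP => [->|].
Qed.

Lemma laplacian_mul n (G : simple_graph n) (x : 'cV[R]_n) i :
  (laplacian R G *m x) i 0 = \sum_j (adj G i j)%:R * (x i 0 - x j 0).
Proof.
rewrite mxE; under eq_bigr do rewrite laplacianE mulrBl.
under [RHS]eq_bigr do rewrite mulrBr.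
rewrite !sumrB; congr (_ - _).
rewrite -mulr_suml -degreeE (bigD1 i) //= eqxx big1 ?addr0 // => j /negbTE ij.
by rewrite eq_sym ij mul0r.
Qed.

Lemma laplacian_const n (G : simple_graph n) (a : R) :
  laplacian R G *m const_mx a = 0 :> 'cV_n.
Proof.
apply/matrixP => i j; rewrite (ord1 j) laplacian_mul big1 ?mxE // => k _.
by rewrite !mxE subrr mulr0.
Qed.

(** The symmetric double sum counts every edge twice, whence the factor 1/2. *)
Lemma laplacian_form n (G : simple_graph n) (x : 'cV[R]_n) :
  (x^T *m laplacian R G *m x) 0 0 =
  2^-1 * \sum_i \sum_j (adj G i j)%:R * (x i 0 - x j 0) ^+ 2.
Proof.
have -> : (x^T *m laplacian R G *m x) 0 0 =
    \sum_i \sum_j (adj G i j)%:R * (x i 0 * (x i 0 - x j 0)).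
  rewrite -mulmxA mxE; apply: eq_bigr => i _; rewrite laplacian_mul mxE.
  by rewrite mulr_sumr; apply: eq_bigr => j _; rewrite mulrCA.
set S := LHS.
have swapS : S = \sum_i \sum_j (adj G i j)%:R * (x j 0 * (x j 0 - x i 0)).
  rewrite /S exchange_big; apply: eq_bigr => i _; apply: eq_bigr => j _.
  by rewrite adj_sym.
suff -> : \sum_i \sum_j (adj G i j)%:R * (x i 0 - x j 0) ^+ 2 = S + S by lra.
rewrite {2}swapS -big_split; apply: eq_bigr => i _.
by rewrite -big_split; apply: eq_bigr => j _ /=; ring.
Qed.

Lemma laplacian_terms_ge0 n (G : simple_graph n) (x : 'cV[R]_n) i j :
  0 <= (adj G i j)%:R * (x i 0 - x j 0) ^+ 2.
Proof. by rewrite mulr_ge0 ?sqr_ge0. Qed.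

Lemma laplacian_psd n (G : simple_graph n) (x : 'cV[R]_n) :
  0 <= (x^T *m laplacian R G *m x) 0 0.
Proof.
rewrite laplacian_form mulr_ge0 ?invr_ge0 //.
by do 2![apply: sumr_ge0 => ? _]; exact: laplacian_terms_ge0.
Qed.

Lemma laplacian_form_eq0 n (G : simple_graph n) (x : 'cV[R]_n) :
  (x^T *m laplacian R G *m x) 0 0 = 0 ->
  forall i j, adj G i j -> x i 0 = x j 0.
Proof.
have terms_ge0 := laplacian_terms_ge0 G x.
rewrite laplacian_form => /eqP; rewrite mulf_eq0 invr_eq0 pnatr_eq0 /=.
rewrite psumr_eq0 => [/allP rows0 i j ij|i _]; last exact: sumr_ge0.
have := rows0 i (mem_index_enum _); rewrite psumr_eq0 //= => /allP entries0.
have := entries0 j (mem_index_enum _).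
by rewrite ij mul1r sqrf_eq0 subr_eq0 => /eqP.
Qed.

Variables (N : nat) (GS : selfloop_graph N).
Let L := sl_laplacian R GS.
Let s := loop_vector R GS.

Lemma sl_laplacian_tr : L^T = L.
Proof. by rewrite /L /sl_laplacian linearD /= laplacian_tr tr_diag_mx. Qed.

(** Constants lie in the kernel of the ordinary Laplacian, so only the loops
contribute.  This identity is what makes all the block computations for the lift
close up. *)
Lemma sl_laplacian_const1 : L *m const_mx 1 = s.
Proof.
rewrite /L /sl_laplacian mulmxDl laplacian_const add0r mul_diag_mx.
by apply/matrixP => i j; rewrite !mxE mulr1.
Qed.

(** If [L x = 0], both nonnegative parts of the quadratic form vanish: [x] is
constant along edges and zero at the loops, and every vertex is connected to a
loop. *)
Lemma sl_laplacian_unit : pseudo_connected GS -> L \in unitmx.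
Proof.
move=> pc; rewrite unitmxE unitfE; apply/negP => /det0P[v v_neq0 vL].
case/negP: v_neq0; apply/eqP; apply: trmx_inj; rewrite trmx0.
set x := v^T.
have xLx : (x^T *m laplacian R (base GS) *m x) 0 0 +
    \sum_i (i \in loops GS)%:R * x i 0 ^+ 2 = 0.
  transitivity ((x^T *m L *m x) 0 0); last by rewrite trmxK vL mul0mx mxE.
  rewrite /L /sl_laplacian [in RHS]mulmxDr [in RHS]mulmxDl [RHS]mxE.
  congr (_ + _).
  rewrite -mulmxA mul_diag_mx [RHS]mxE; apply: eq_bigr => i _; rewrite !mxE.
  by rewrite expr2 mulrCA.
have loops_ge0 i : 0 <= (i \in loops GS)%:R * x i 0 ^+ 2.
  by rewrite mulr_ge0 ?sqr_ge0.
move/eqP: xLx; rewrite paddr_eq0 ?laplacian_psd ?sumr_ge0 //.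
case/andP => /eqP/laplacian_form_eq0 x_adj.
rewrite psumr_eq0 // => /allP x_loops.
apply/matrixP => i j; rewrite (ord1 j) [RHS]mxE.
have [w w_loop i_w] := pc i.
have x_w : x w 0 = 0.
  have := x_loops w (mem_index_enum _).
  by rewrite /= w_loop mul1r sqrf_eq0 => /eqP.
have x_closed : fingraph.closed (adj (base GS)) [pred k | x k 0 == 0].
  by move=> k l kl; rewrite !inE (x_adj _ _ kl).
by have := closed_connect x_closed i_w; rewrite !inE x_w eqxx => /eqP.
Qed.

End Laplacian.

(** * Adjacency in the lift *)

(** An equality of unordered pairs is an equality of ordered pairs up to
exchange; it reduces the adjacency of the lift to equations between vertices. *)
Lemma eq_set2 (T : finType) (a b c d : T) :
  ([set a; b] == [set c; d]) = (a == c) && (b == d) || (a == d) && (b == c).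
Proof.
apply/eqP/orP => [E|[]/andP[/eqP-> /eqP->] //]; last exact: finset.setUC.
have inE_ x : (x \in [set a; b]) = (x \in [set c; d]) by rewrite E.
have := inE_ a; have := inE_ b; have := inE_ c; have := inE_ d.
rewrite !inE !eqxx ?orbT /= (eq_sym d a) (eq_sym d b) (eq_sym c a) (eq_sym c b).
move=> dab cab bcd acd; apply/orP; move: dab cab bcd acd.
by move: (a == c) (a == d) (b == c) (b == d) => [] [] [] [].
Qed.

Section LiftAdjacency.
Variables (N : nat) (GS : selfloop_graph N).

Lemma lo_eq (i j : 'I_N) : (lo i == lo j) = (i == j).
Proof. by rewrite /lo !(inj_eq (@lshift_inj _ _)). Qed.
Lemma hi_eq (i j : 'I_N) : (hi i == hi j) = (i == j).
Proof. by rewrite /hi (inj_eq (@rshift_inj _ _)). Qed.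
Lemma lo_hi (i j : 'I_N) : (lo i == hi j) = false.
Proof. by rewrite /lo /hi eq_lrshift. Qed.
Lemma lo_mid (i : 'I_N) : (lo i == mid N) = false.
Proof. by rewrite /lo /mid (inj_eq (@lshift_inj _ _)) eq_lrshift. Qed.
Lemma hi_mid (i : 'I_N) : (hi i == mid N) = false.
Proof. by rewrite eq_sym /hi /mid eq_lrshift. Qed.
Lemma hi_lo (i j : 'I_N) : (hi i == lo j) = false.
Proof. by rewrite eq_sym lo_hi. Qed.
Lemma mid_lo (i : 'I_N) : (mid N == lo i) = false.
Proof. by rewrite eq_sym lo_mid. Qed.
Lemma mid_hi (i : 'I_N) : (mid N == hi i) = false.
Proof. by rewrite eq_sym hi_mid. Qed.

Definition vertexE :=
  (lo_eq, hi_eq, lo_hi, hi_lo, lo_mid, hi_mid, mid_lo, mid_hi, eqxx).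

Lemma adj_lo_lo i j : lift_adj GS (lo i) (lo j) = adj (base GS) i j.
Proof.
apply/idP/idP => [/orP[]|ij]; last first.
  apply/orP; left; apply/existsP; exists i; apply/existsP; exists j.
  by rewrite ij eqxx.
  by case/existsP => k; rewrite !eq_set2 !vertexE /= !andbF.
case/existsP => i' /existsP[j' /andP[ij']].
rewrite !eq_set2 !vertexE /= orbF.
by case/orP => /andP[/eqP -> /eqP ->] //; rewrite adj_sym.
Qed.

Lemma adj_hi_hi i j : lift_adj GS (hi i) (hi j) = adj (base GS) i j.
Proof.
apply/idP/idP => [/orP[]|ij]; last first.
  apply/orP; left; apply/existsP; exists i; apply/existsP; exists j.
  by rewrite ij eqxx orbT.
  by case/existsP => k; rewrite !eq_set2 !vertexE /= !andbF.
case/existsP => i' /existsP[j' /andP[ij']].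
rewrite !eq_set2 !vertexE /=.
by case/orP => /andP[/eqP -> /eqP ->] //; rewrite adj_sym.
Qed.

Lemma adj_lo_hi i j : lift_adj GS (lo i) (hi j) = false.
Proof.
apply/negP => /orP[/existsP[i' /existsP[j']]|/existsP[k]];
  by rewrite !eq_set2 !vertexE /= ?andbF.
Qed.

Lemma adj_lo_mid i : lift_adj GS (lo i) (mid N) = (i \in loops GS).
Proof.
apply/idP/idP => [/orP[]|i_loop]; last first.
  by apply/orP; right; apply/existsP; exists i; rewrite i_loop eqxx.
  case/existsP => k; rewrite !eq_set2 !vertexE /= ?andbF ?andbT ?orbF.
  by case/andP => + /eqP ->.
by case/existsP => i' /existsP[j']; rewrite !eq_set2 !vertexE /= ?andbF.
Qed.

Lemma adj_hi_mid i : lift_adj GS (hi i) (mid N) = (i \in loops GS).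
Proof.
apply/idP/idP => [/orP[]|i_loop]; last first.
  apply/orP; right; apply/existsP; exists i.
  by rewrite i_loop finset.setUC eqxx orbT.
  case/existsP => k; rewrite !eq_set2 !vertexE /= ?andbF ?andbT ?orbF.
  by case/andP => + /eqP ->.
by case/existsP => i' /existsP[j']; rewrite !eq_set2 !vertexE /= ?andbF.
Qed.

End LiftAdjacency.

(** * A generalized inverse of the Laplacian of the lift *)

Section Lift.
Variables (R : realType) (N : nat) (GS : selfloop_graph N).
Local Notation L := (sl_laplacian R GS).
Local Notation s := (loop_vector R GS).
Local Notation one := (const_mx 1 : 'cV[R]_N).
Local Notation Lam := (laplacian R (acikmese_lift GS)).

Lemma big_lift_vertices (V : nmodType) (F : 'I_(N + 1 + N) -> V) :
  \sum_x F x = \sum_i F (lo i) + F (mid N) + \sum_i F (hi i).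
Proof. by rewrite big_split_ord big_split_ord big_ord1. Qed.

Lemma lift_vertex_ind (P : 'I_(N + 1 + N) -> Prop) :
  (forall i, P (lo i)) -> P (mid N) -> (forall i, P (hi i)) -> forall x, P x.
Proof.
move=> Plo Pmid Phi x.
case: (fintype.split_ordP x) => [y ->|i ->]; last exact: Phi.
case: (fintype.split_ordP y) => [i ->|j ->]; first exact: Plo.
by rewrite (ord1 j); exact: Pmid.
Qed.

Lemma degree_lo i : (degree (acikmese_lift GS) (lo i))%:R =
  (degree (base GS) i)%:R + (i \in loops GS)%:R :> R.
Proof.
rewrite !degreeE big_lift_vertices /= adj_lo_mid.
rewrite [X in _ + X]big1 => [|j _]; last by rewrite adj_lo_hi.
by rewrite addr0; congr (_ + _); apply: eq_bigr => j _; rewrite adj_lo_lo.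
Qed.

Lemma degree_hi i : (degree (acikmese_lift GS) (hi i))%:R =
  (degree (base GS) i)%:R + (i \in loops GS)%:R :> R.
Proof.
rewrite !degreeE big_lift_vertices /= adj_hi_mid.
rewrite [X in X + _ + _]big1 => [|j _]; last by rewrite lift_adj_sym adj_lo_hi.
by rewrite add0r addrC; congr (_ + _); apply: eq_bigr => j _; rewrite adj_hi_hi.
Qed.

Lemma degree_mid : (degree (acikmese_lift GS) (mid N))%:R =
  (s^T *m one + s^T *m one) 0 0.
Proof.
rewrite !degreeE big_lift_vertices /= lift_adj_irr addr0 !mxE.
congr (_ + _); apply: eq_bigr => i _;
  by rewrite lift_adj_sym (adj_lo_mid, adj_hi_mid) !mxE mulr1.
Qed.

Lemma sl_laplacianE i j : L i j =
  ((degree (base GS) i)%:R + (i \in loops GS)%:R) *+ (i == j)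
  - (adj (base GS) i j)%:R.
Proof. by rewrite /sl_laplacian mxE laplacianE !mxE mulrnDl addrAC. Qed.

(** The blocks follow the order lower copy, middle vertex, upper copy.  The middle
entry 2|S| is written with s^T 1 = |S|, the form in which block products yield
it. *)
Lemma lift_laplacian_block : Lam =
  block_mx (block_mx L (- s) (- s^T) (s^T *m one + s^T *m one))
           (col_mx 0 (- s^T)) (row_mx 0 (- s)) L.
Proof.
apply/matrixP => x y; rewrite laplacianE /=.
move: x y; apply: lift_vertex_ind => [i||i]; apply: lift_vertex_ind => [j||j];
  rewrite ?vertexE ?mulr0n ?mulr1n ?sub0r /lo /mid /hi;
  rewrite ?block_mxEul ?block_mxEur ?block_mxEdl ?block_mxEdr
          ?col_mxEu ?col_mxEd ?row_mxEl ?row_mxEr -/(lo _) -/(mid _) -/(hi _).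
- by rewrite degree_lo adj_lo_lo sl_laplacianE.
- by rewrite adj_lo_mid !mxE.
- by rewrite adj_lo_hi !mxE oppr0.
- by rewrite lift_adj_sym adj_lo_mid !mxE.
- by rewrite degree_mid lift_adj_irr subr0.
- by rewrite lift_adj_sym adj_hi_mid !mxE.
- by rewrite lift_adj_sym adj_lo_hi !mxE oppr0.
- by rewrite adj_hi_mid !mxE.
- by rewrite degree_hi adj_hi_hi sl_laplacianE.
Qed.

(** Grounding the middle vertex decouples the two copies, each of which then
carries the invertible matrix [L]; [grounded_inv] inverts the grounded Laplacian
and vanishes at the middle vertex. *)
Definition grounded_inv : 'M[R]_(N + 1 + N) :=
  block_mx (block_mx (invmx L) 0 0 0) 0 0 (invmx L).

Hypothesis pc : pseudo_connected GS.
Let Lu : L \in unitmx := sl_laplacian_unit R pc.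

Lemma invmx_loop_vector : invmx L *m s = one.
Proof. by rewrite -(sl_laplacian_const1 R GS) mulKmx. Qed.

Lemma loop_vector_invmx : s^T *m invmx L = one^T.
Proof.
by rewrite -invmx_loop_vector trmx_mul trmx_inv sl_laplacian_tr.
Qed.

Lemma grounded_inv_laplacian : grounded_inv *m Lam =
  block_mx (block_mx 1%:M (- one) 0 0) 0 (row_mx 0 (- one)) 1%:M.
Proof.
rewrite lift_laplacian_block /grounded_inv.
rewrite !mulmx_block mul_block_col !mul_mx_row.
rewrite !mul0mx !mulmx0 !addr0 !add0r !mulmxN invmx_loop_vector mulVmx //.
by rewrite row_mx0 col_mx0 addr0.
Qed.

(** The grounded inverse is a generalized inverse, since L 1 = s reproduces the
middle row and column. *)
Lemma laplacian_grounded_invK : Lam *m grounded_inv *m Lam = Lam.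
Proof.
rewrite -mulmxA grounded_inv_laplacian lift_laplacian_block !mulmx_block.
rewrite mul_row_block mul_col_row !mul_mx_row !mulmx0 !mulmx1 !addr0 !add0r.
rewrite !mul0mx !mulmxN !mulNmx !opprK sl_laplacian_const1.
by rewrite add_block_mx add_row_mx ?mulmx0 ?oppr0 ?addr0 ?add0r.
Qed.

(** The lower and upper blocks of [grounded_inv *m Lam *m x] are the deviations of
[x] from its value at the middle vertex. *)
Lemma lift_laplacian_ker (x : 'cV_(N + 1 + N)) :
  Lam *m x = 0 -> exists c, x = const_mx c.
Proof.
move=> /(congr1 (mulmx grounded_inv)).
rewrite mulmxA grounded_inv_laplacian mulmx0.
rewrite -[x]vsubmxK -[usubmx x]vsubmxK.
set a := usubmx (usubmx x); set m := dsubmx (usubmx x); set b := dsubmx x.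
rewrite !mul_block_col !mul_row_col !mul0mx !mul1mx !addr0 !add0r.
rewrite -[0 in RHS]vsubmxK => /eq_col_mx[].
rewrite -[usubmx 0]vsubmxK => /eq_col_mx[] + _; rewrite !linear0.
have -> : - one *m m = - const_mx (m 0 0).
  rewrite mulNmx; congr (- _); apply/matrixP => i j.
  by rewrite !mxE big_ord1 !mxE mul1r (ord1 j).
move=> /eqP; rewrite subr_eq0 => /eqP ->.
move=> /eqP; rewrite addrC subr_eq0 => /eqP ->.
have mE : m = const_mx (m 0 0).
  by apply/matrixP => i j; rewrite (ord1 i) (ord1 j) [RHS]mxE.
by exists (m 0 0); rewrite [X in col_mx (col_mx _ X)]mE !col_mx_const.
Qed.

Local Notation J := (const_mx 1 : 'M[R]_(N + 1 + N)).
Local Notation T := (involution_mx N R).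
Local Notation nV := ((N + 1 + N)%:R : R).

Let nV_neq0 : nV != 0.
Proof. by rewrite pnatr_eq0 addn1. Qed.

(** Columns of [Q], and by symmetry its rows, lie in the kernel, so all entries of
[Q] agree; fixing the all-ones vector determines their common value. *)
Lemma lift_kernel_projector (Q : 'M[R]_(N + 1 + N)) :
  Lam *m Q = 0 -> Q *m Lam = 0 ->
  (forall x : 'cV_(N + 1 + N), Lam *m x = 0 -> Q *m x = x) ->
  Q = nV^-1 *: J.
Proof.
move=> LamQ QLam Qker.
have col_const (M : 'M[R]_(N + 1 + N)) i i' j : Lam *m M = 0 -> M i j = M i' j.
  move=> LamM; have [|c colM] := @lift_laplacian_ker (col j M).
    by rewrite colE mulmxA LamM mul0mx.
  by have /colP e := colM; move: (e i) (e i'); rewrite !mxE => -> ->.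
have QE i j : Q i j = Q (mid N) (mid N).
  rewrite (col_const _ i (mid N)) //.
  have := col_const Q^T j (mid N) (mid N); rewrite !mxE; apply.
  by rewrite -[Lam]laplacian_tr -trmx_mul QLam trmx0.
have : nV * Q (mid N) (mid N) = 1.
  have /colP/(_ (mid N)) := Qker (const_mx 1) (laplacian_const _ _).
  rewrite !mxE; under eq_bigr do rewrite QE mxE mulr1.
  by rewrite sumr_const card_ord mulr_natl.
move=> /(congr1 (fun x => nV^-1 * x)); rewrite mulKf // mulr1 => q.
by apply/matrixP => i j; rewrite QE q !mxE mulr1.
Qed.

Lemma involution_mx_mulJ : T *m J = J.
Proof. by rewrite -row_permE; apply/matrixP => i j; rewrite !mxE. Qed.

Lemma mulJ_involution_mx : J *m T = J.
Proof.
rewrite -[T]trmxK tr_perm_mx -[J]trmxK -trmx_mul trmx_const -row_permE.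
by apply/matrixP => i j; rewrite !mxE.
Qed.

Lemma mulJJ : J *m J = nV *: J.
Proof.
apply/matrixP => i j; rewrite !mxE; under eq_bigr do rewrite !mxE mulr1.
by rewrite sumr_const card_ord mulr1.
Qed.

Lemma trace_J : \tr J = nV.
Proof.
by rewrite /mxtrace; under eq_bigr do rewrite mxE; rewrite sumr_const card_ord.
Qed.

(** The swap moves every diagonal entry into a zero block, except the middle one,
where [grounded_inv] vanishes. *)
Lemma trace_grounded_inv_involution : \tr (grounded_inv *m T) = 0.
Proof.
have -> : \tr (grounded_inv *m T) = \sum_x grounded_inv x (swap x).
  apply: eq_bigr => x _; rewrite mxE (bigD1 (swap x)) //= big1 => [|y y_neq].
    by rewrite !mxE permE swapK eqxx mulr1 addr0.
  rewrite !mxE permE (_ : swap y == x = false) ?mulr0 //.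
  by apply: contra_neqF y_neq => /eqP <-; rewrite swapK.
rewrite big_lift_vertices swap_mid !big1 ?addr0 ?add0r => [|i _|i _].
- by rewrite block_mxEul block_mxEdr mxE.
- by rewrite swap_hi block_mxEdl mxE.
- by rewrite swap_lo block_mxEur mxE.
Qed.

Lemma trace_grounded_inv_J :
  \tr (grounded_inv *m J) = 2 * (one^T *m invmx L *m one) 0 0.
Proof.
have JE : J = (const_mx 1 : 'cV_(N + 1 + N)) *m (const_mx 1)^T.
  by apply/matrixP => i j; rewrite !mxE big_ord1 !mxE mulr1.
rewrite JE mulmxA mxtrace_mulC mulmxA trace_mx11.
have -> : (const_mx 1 : 'cV[R]_(N + 1 + N)) =
    col_mx (col_mx one (const_mx 1)) one.
  by rewrite !col_mx_const.
rewrite /grounded_inv !tr_col_mx !mul_row_block !mulmx0 !addr0 !add0r mul_row_col.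
by rewrite mul_row_col mul0mx addr0 mxE mulr2n mulrDl mul1r.
Qed.
End Lift.

(** * The regularized equivariant heat integral *)

Theorem theorem5p23 (R : realType) (N : nat) (GS : selfloop_graph N) :
  pseudo_connected GS ->
  (1 <= #|loops GS|)%N ->
  let s := loop_vector R GS in
  let L := sl_laplacian R GS in
  eq_heat_integral R GS =
    (- (2 * (s^T *m invmx L ^+ 3 *m s) 0 0
        / (1 + 2 * (s^T *m invmx L ^+ 2 *m s) 0 0)))%:E.
Proof.
move=> pc _ s L.
pose Lam := laplacian R (acikmese_lift GS).
pose J : 'M[R]_(N + 1 + N) := const_mx 1.
pose T := involution_mx N R.
pose n : R := (N + 1 + N)%:R.
have n_neq0 : n != 0 by rewrite pnatr_eq0 addn1.
have [Q [LamQ QLam Qker]] := integral_heat_trace T (laplacian_tr R _)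
  (laplacian_psd (acikmese_lift GS)) (laplacian_grounded_invK R pc).
have QE : Q = n^-1 *: J := lift_kernel_projector pc LamQ QLam Qker.
have QT : Q *m T = Q by rewrite QE -scalemxAl mulJ_involution_mx.
have TQ : T *m Q = Q by rewrite QE -scalemxAr involution_mx_mulJ.
have QQ : Q *m Q = Q.
  by rewrite QE -scalemxAl -scalemxAr mulJJ !scalerA -mulrA mulVf // mulr1.
have trQT : \tr (Q *m T) = 1 by rewrite QT QE mxtraceZ trace_J mulVf.
have QTQ : (1%:M - Q) *m T *m (1%:M - Q) = T - Q.
  by rewrite mulmxBl mul1mx mulmxBr mulmx1 QT mulmxBl TQ QQ subrr subr0.
rewrite trQT QTQ mulmxBr linearB /= trace_grounded_inv_involution // sub0r.
rewrite QE -scalemxAr mxtraceZ trace_grounded_inv_J => heatE.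
rewrite /eq_heat_integral /eq_heat_trace heatE; congr (- _)%:E.
have -> : s^T *m invmx L ^+ 3 *m s = (const_mx 1)^T *m invmx L *m const_mx 1.
  rewrite exprS expr2 -!mulmxE !mulmxA (loop_vector_invmx _ pc).
  by rewrite -mulmxA (invmx_loop_vector _ pc).
have -> : s^T *m invmx L ^+ 2 *m s = N%:R%:M.
  rewrite expr2 -mulmxE !mulmxA (loop_vector_invmx _ pc).
  rewrite -mulmxA (invmx_loop_vector _ pc).
  apply/matrixP => i j; rewrite !mxE !ord1.
  under eq_bigr do rewrite !mxE mulr1.
  by rewrite sumr_const card_ord.
rewrite mulrC; congr (_ / _).
by rewrite mxE eqxx mulr1n /n !natrD; ring.
Qed.
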